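(* Let $n\geq 2$, and let $S^{n-1}=\{y\in\mathbb{R}^n:\sum_{i=1}^n|y_i|^2=1\}$ be the Euclidean unit sphere equipped with the geodesic distance $\rho$ and the normalized Haar (rotation-invariant probability) measure $\sigma_{n-1}$. Let $\mathcal{F}$ be the class of all $\sigma_{n-1}$-integrable functions $f:S^{n-1}\to\mathbb{R}$ that are $1$-Lipschitz with respect to $\rho$, and put $$D(x)=\sup_{f\in \mathcal{F}}\sigma_{n-1}\{u: f(u)-\mathbf{E}_{\sigma_{n-1}} f\geq x\},\qquad x\in\mathbb{R}.$$ Then for every $x\in\mathbb{R}$ there is a cap $A_{\mathrm{opt}}\subset S^{n-1}$ such that, with $f^{\ast}(u)=-\rho(A_{\mathrm{opt}},u)$, $$D(x)=\sigma_{n-1}\{u: f^{\ast}(u)-\mathbf{E}_{\sigma_{n-1}} f^{\ast}\geq x\}.$$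
   Context: A cap is a ball for the geodesic distance $\rho$ on $S^{n-1}$. A function $f$ is $1$-Lipschitz with respect to $\rho$ if $|f(u)-f(v)|\leq\rho(u,v)$ for all $u,v$. $\mathbf{E}_{\sigma_{n-1}} f=\int f\,d\sigma_{n-1}$. For a set $A$ and a point $u$, $\rho(A,u)=\inf_{a\in A}\rho(a,u)$. *)

(* Defs.v *)
From HB Require Import structures.
From mathcomp Require Import all_boot all_order all_algebra.
From mathcomp Require Import all_classical all_reals all_analysis.

Set Implicit Arguments.
Unset Strict Implicit.
Unset Printing Implicit Defensive.

Import Order.TTheory GRing.Theory Num.Theory.
Import numFieldNormedType.Exports.

Local Open Scope classical_set_scope.
Local Open Scope ring_scope.

Definition unit_sphere (R : realType) (m : nat) : set 'rV[R]_m.+1 :=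
  [set y | \sum_(i < m.+1) `|y ord0 i| ^+ 2 = 1].

(* [sphere R m] is S^m, the unit sphere of R^(m+1), so that S^(n-1) is
   [sphere R n.-1] when n > 0; indexing by m makes the type nonempty, as
   measurable types are required to be pointed. *)
Definition sphere (R : realType) (m : nat) : Type := set_type (@unit_sphere R m).

Lemma unit_sphere_base (R : realType) (m : nat) :
  (delta_mx ord0 ord0 : 'rV[R]_m.+1) \in @unit_sphere R m.
Proof.
rewrite inE /unit_sphere /= (bigD1 ord0) //= big1 => [|i i0].
  by rewrite mxE !eqxx normr1 expr1n addr0.
by rewrite mxE eqxx (negbTE i0) normr0 expr0n.
Qed.

HB.instance Definition _ (R : realType) (m : nat) :=
  Topological.copy (sphere R m)
    (initial_topology (@set_val _ (@unit_sphere R m))).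
HB.instance Definition _ (R : realType) (m : nat) :=
  isPointed.Build (sphere R m) (exist (fun y => y \in @unit_sphere R m) _ (unit_sphere_base R m)).

(* The Borel sigma-algebra of the topology induced by R^(m+1). *)
HB.instance Definition _ (R : realType) (m : nat) :=
  @isMeasurable.Build (sigma_display (@open (sphere R m))) (sphere R m)
    <<s @open (sphere R m) >> (@sigma_algebra0 _ setT _)
    (@sigma_algebraC _ _) (@sigma_algebra_bigcup _ setT _).

Section SphereDefs.
Context {R : realType} {m : nat}.
Implicit Types (A : set (sphere R m)) (f : sphere R m -> R) (x : R).

(* The great-circle distance: the angle between the two unit vectors. *)
Definition rho (u v : sphere R m) : R :=
  acos (\sum_(i < m.+1) val u ord0 i * val v ord0 i).

Definition rho_set A (u : sphere R m) : R := inf [set rho a u | a in A].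

Definition is_cap A : Prop :=
  exists (c : sphere R m) (r : R), 0 < r /\ A = [set u | rho c u <= r].

(* Rotations are the elements of SO(m+1), acting on row vectors on the right. *)
Definition is_rotation (T : sphere R m -> sphere R m) : Prop :=
  exists Q : 'M[R]_m.+1,
    [/\ Q *m Q^T = 1%:M, \det Q = 1 & forall u, val (T u) = val u *m Q].

(* For m >= 1 there is exactly one rotation-invariant Borel probability measure
   on S^m, so this property characterizes the normalized Haar measure. *)
Definition rotation_invariant (sigma : probability (sphere R m) R) : Prop :=
  forall T, is_rotation T ->
  forall A, measurable A -> sigma (T @^-1` A) = sigma A.

Variable sigma : probability (sphere R m) R.

Definition lip1_class : set (sphere R m -> R) :=
  [set f | sigma.-integrable setT (EFin \o f) /\
           forall u v, `|f u - f v| <= rho u v].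

Definition deviation f x : \bar R :=
  sigma [set u | (x%:E <= (f u)%:E - 'E_sigma[f])%E].

Definition sup_deviation x : \bar R :=
  ereal_sup [set deviation f x | f in lip1_class].

End SphereDefs.

(* Main.v *)
Require Import Defs.
From HB Require Import structures.
From mathcomp Require Import all_boot all_order all_algebra.
From mathcomp Require Import all_classical all_reals all_analysis.
From mathcomp Require Import measurable_realfun lra.

Set Implicit Arguments.
Unset Strict Implicit.
Unset Printing Implicit Defensive.

Import Order.TTheory GRing.Theory Num.Theory.
Import numFieldNormedType.Exports.

Local Open Scope classical_set_scope.
Local Open Scope ring_scope.

(** Why the theorem holds.

    For [x <= 0] the cap of radius [pi] is the whole sphere, its function is
    constantly [0] and the deviation is [1].  So let [x > 0] and let [f] be
    1-Lipschitz with superlevel set [A = {f - E f >= x}] of positive measure.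

    The heart of the matter is that [f] may be replaced by an equimeasurable
    1-Lipschitz function [g] that is nonincreasing in the distance to a fixed
    pole [c] ([radial_rearrangement]).  It is obtained without any isoperimetric
    inequality for sets: among the 1-Lipschitz functions equimeasurable with
    [f], one that minimizes [E (rho c * g)] exists by compactness
    ([equimeasurable_minimizer]), and it has to be radially monotone.  Indeed,
    if [rho c u < rho c v] but [g u < g v], take the mirror [s] exchanging [u]
    and [v], and polarize: on each pair [{z, s z}] put the larger value of [g] on
    the side of [c].  Polarization keeps [g] 1-Lipschitz ([polarize_lip1]) and
    equimeasurable with [f] ([mean_polarize]), but strictly decreases the
    functional ([polarize_decreases]).

    The set [{g - E g >= x}] has at least the measure of [A].  It lies between
    the open and the closed ball about [c] of some radius [r > 0], so
    [g >= E g + x - rho(cap r', _)] for all [r' < r]; integrating,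
    [E rho(cap r', _) >= x] ([cap_dominates]).  Now [E rho(cap r, _)] is
    continuous and nonincreasing in [r].  Let [r_max] be the largest [r] for
    which it is at least [x].  The cap of radius [r_max] contains the cap of
    radius [r], and the deviation of its function at [x] is at least its own
    measure, hence at least the measure of [A].  If no [r > 0] qualifies, all the
    sets [A] are null and any cap will do.

    Polarization needs invariance under single mirrors, whereas the hypothesis
    only gives it for rotations.  A product of two mirrors is a rotation, and
    such products act transitively, so all balls of a given radius have the same
    measure; a double integration against the kernel [1_(rho u (s v) < e)] then
    compares [E F] with [E (F o s)] up to [L e] for each [L]-Lipschitz [F]
    ([mean_mirror_le], [mean_mirror]). *)

Local Notation lip1 f := (forall u v, `|f u - f v| <= rho u v).

(** * Spherical geometry: the geodesic distance and mirrors *)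

Section Geometry.
Context {R : realType} {m : nat}.
Implicit Types (x y z : 'rV[R]_m.+1) (u v w c : sphere R m).

Definition dotp x y : R := \sum_(i < m.+1) x ord0 i * y ord0 i.

Lemma dotpC x y : dotp x y = dotp y x.
Proof. by apply: eq_bigr => i _; rewrite mulrC. Qed.

Lemma dotpDl x y z : dotp (x + y) z = dotp x z + dotp y z.
Proof. by rewrite -big_split; apply: eq_bigr => i _; rewrite mxE mulrDl. Qed.

Lemma dotpZl (a : R) x y : dotp (a *: x) y = a * dotp x y.
Proof. by rewrite big_distrr; apply: eq_bigr => i _; rewrite mxE /= mulrA. Qed.

Lemma dotpNl x y : dotp (- x) y = - dotp x y.
Proof. by rewrite -scaleN1r dotpZl mulN1r. Qed.

Lemma dotpDr x y z : dotp x (y + z) = dotp x y + dotp x z.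
Proof. by rewrite dotpC dotpDl !(dotpC x). Qed.

Lemma dotpZr (a : R) x y : dotp x (a *: y) = a * dotp x y.
Proof. by rewrite dotpC dotpZl (dotpC x). Qed.

Lemma dotpNr x y : dotp x (- y) = - dotp x y.
Proof. by rewrite dotpC dotpNl (dotpC x). Qed.

Definition dotpE := (dotpDl, dotpDr, dotpNl, dotpNr, dotpZl, dotpZr).

Lemma dotp_ge0 x : 0 <= dotp x x.
Proof. by apply: sumr_ge0 => i _; rewrite -expr2 sqr_ge0. Qed.

Lemma dotp_eq0 x : dotp x x = 0 -> x = 0.
Proof.
move=> /eqP; rewrite psumr_eq0; last by move=> i _; rewrite -expr2 sqr_ge0.
move=> /allP x0; apply/rowP => i; rewrite mxE; apply/eqP.
by have := x0 i (mem_index_enum i); rewrite mulf_eq0 orbb.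
Qed.

Lemma dotp_gt0 x : x != 0 -> 0 < dotp x x.
Proof.
by rewrite lt0r dotp_ge0 andbT; apply: contra_neq; exact: dotp_eq0.
Qed.

(** Nonnegativity of the square of [(y.y) x - (x.y) y], divided by [y.y]. *)
Lemma cauchy_schwarz x y : dotp x y ^+ 2 <= dotp x x * dotp y y.
Proof.
have [->|/dotp_gt0 y0] := eqVneq y 0.
  by rewrite -(scale0r x) !dotpE !mul0r mulr0 expr0n.
rewrite -subr_ge0 -(pmulr_rge0 _ y0).
have := dotp_ge0 (dotp y y *: x - dotp x y *: y); rewrite !dotpE (dotpC y x).
congr (0 <= _); lra.
Qed.

Lemma in_unit_sphere x : (x \in @unit_sphere R m) <-> dotp x x = 1.
Proof.
rewrite inE /unit_sphere /= (_ : \sum_i _ = dotp x x)//.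
by apply: eq_bigr => i _; rewrite real_normK ?num_real// expr2.
Qed.

Lemma dotp_sphere u : dotp (val u) (val u) = 1.
Proof. by apply/in_unit_sphere; exact: valP. Qed.

Lemma sphere_point x : dotp x x = 1 -> {u : sphere R m | val u = x}.
Proof.
move=> /in_unit_sphere xS.
by exists (exist (fun y => y \in @unit_sphere R m) x xS).
Qed.

Lemma sphere_normalize x : x != 0 ->
  {u : sphere R m | x = Num.sqrt (dotp x x) *: val u}.
Proof.
move=> /dotp_gt0 x0.
have s0 : Num.sqrt (dotp x x) != 0 by rewrite gt_eqF// sqrtr_gt0.
have [|u uE] := @sphere_point ((Num.sqrt (dotp x x))^-1 *: x).
  rewrite !dotpE mulrA -expr2 exprVn sqr_sqrtr ?mulVf// ?gt_eqF//; exact: ltW.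
by exists u; rewrite uE scalerA divff// scale1r.
Qed.

Lemma dotp_itv u v : -1 <= dotp (val u) (val v) <= 1.
Proof.
have := cauchy_schwarz (val u) (val v); rewrite !dotp_sphere mul1r => h.
by rewrite -ler_norml -(ler_pXn2r (n := 2))// ?nnegrE// real_normK ?num_real// expr1n.
Qed.

Lemma rhoE u v : rho u v = acos (dotp (val u) (val v)).
Proof. by []. Qed.

Lemma cos_rho u v : cos (rho u v) = dotp (val u) (val v).
Proof. by rewrite acosK// in_itv; exact: dotp_itv. Qed.

Lemma rho_ge0 u v : 0 <= rho u v.
Proof. by rewrite acos_ge0// dotp_itv. Qed.

Lemma rho_lepi u v : rho u v <= pi.
Proof. by rewrite acos_lepi// dotp_itv. Qed.

Lemma rho_in u v : rho u v \in `[0, pi].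
Proof. by rewrite in_itv /= rho_ge0 rho_lepi. Qed.

Lemma rhoC u v : rho u v = rho v u.
Proof. by rewrite !rhoE dotpC. Qed.

Lemma rhoxx u : rho u u = 0.
Proof. by rewrite rhoE dotp_sphere acos1. Qed.

Lemma rho_le u v u' v' :
  (rho u v <= rho u' v') = (dotp (val u') (val v') <= dotp (val u) (val v)).
Proof. by rewrite -!cos_rho leNgt [RHS]leNgt ltr_cos ?rho_in. Qed.

Lemma rho_lt u v u' v' :
  (rho u v < rho u' v') = (dotp (val u') (val v') < dotp (val u) (val v)).
Proof. by rewrite -!cos_rho ltr_cos ?rho_in. Qed.

Lemma rho_cosP u v (t : R) : 0 <= t <= pi -> dotp (val u) (val v) = cos t ->
  rho u v = t.
Proof. by move=> t0 h; apply: cos_inj; rewrite ?rho_in ?in_itv// cos_rho. Qed.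

Lemma rho_eq0 u v : rho u v <= 0 -> u = v.
Proof.
rewrite -(rhoxx u) rho_le dotp_sphere => h.
apply: val_inj; apply: subr0_eq; apply: dotp_eq0.
apply/eqP; rewrite eq_le dotp_ge0 andbT !dotpE !dotp_sphere (dotpC (val v)).
lra.
Qed.

(** By monotonicity of [cos] it suffices that [cos (rho u v + rho v w) <= u.w];
    expanding the cosine, this is Cauchy-Schwarz for the components of [u] and [w]
    orthogonal to [v], whose norms are the sines. *)
Lemma rho_triangle u v w : rho u w <= rho u v + rho v w.
Proof.
have [ge_pi|lt_pi] := leP pi (rho u v + rho v w).
  exact: le_trans (rho_lepi _ _) ge_pi.
have ab : rho u v + rho v w \in `[0, pi].
  by rewrite in_itv /= addr_ge0 ?rho_ge0// ltW.
suff: cos (rho u v + rho v w) <= cos (rho u w).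
  by rewrite leNgt [in X in _ -> X]leNgt ltr_cos ?rho_in.
rewrite cosD !cos_rho.
have s1 : 0 <= sin (rho u v) by rewrite sin_ge0_pi// rho_ge0 rho_lepi.
have s2 : 0 <= sin (rho v w) by rewrite sin_ge0_pi// rho_ge0 rho_lepi.
have e1 := sin2cos2 (rho u v); have e2 := sin2cos2 (rho v w).
rewrite cos_rho in e1; rewrite cos_rho in e2.
pose a := val u - dotp (val u) (val v) *: val v.
pose b := val w - dotp (val v) (val w) *: val v.
have := cauchy_schwarz a b.
have -> : dotp a a = sin (rho u v) ^+ 2.
  by rewrite e1 !dotpE !dotp_sphere (dotpC (val v) (val u)); lra.
have -> : dotp b b = sin (rho v w) ^+ 2.
  by rewrite e2 !dotpE !dotp_sphere (dotpC (val w) (val v)); lra.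
have -> : dotp a b =
    dotp (val u) (val w) - dotp (val u) (val v) * dotp (val v) (val w).
  by rewrite !dotpE !dotp_sphere; lra.
set d := _ - _; rewrite -exprMn => h.
have : `|d| <= sin (rho u v) * sin (rho v w).
  by rewrite -(ler_pXn2r (n := 2)) ?nnegrE ?mulr_ge0// real_normK ?num_real.
rewrite ler_norml /d; lra.
Qed.

Hypothesis m_gt0 : (0 < m)%N.

(** The orthogonal complement of a line in dimension [m + 1 >= 2] is not zero. *)
Lemma sphere_orthogonal u : exists e : sphere R m, dotp (val u) (val e) = 0.
Proof.
have : kermx (val u)^T != 0.
  rewrite -mxrank_eq0 mxrank_ker subn_eq0 -ltnNge.
  by rewrite (leq_ltn_trans (rank_leq_col _)).
move=> /rowV0Pn[x /sub_kermxP xu x0].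
have [e xE] := sphere_normalize x0; exists e.
suff h : dotp x (val u) = 0.
  have := h; rewrite xE dotpZl dotpC => /eqP; rewrite mulf_eq0 => /orP[|/eqP//].
  by rewrite gt_eqF// sqrtr_gt0 dotp_gt0.
have /matrixP/(_ ord0 ord0) := xu; rewrite !mxE => <-.
by apply: eq_bigr => i _; rewrite !mxE.
Qed.

(** Polar coordinates about [u].  When [v] is [u] or [- u], the sine vanishes and
    any direction [e] orthogonal to [u] serves. *)
Lemma sphere_polar u v : exists e : sphere R m,
  dotp (val u) (val e) = 0 /\
  val v = cos (rho u v) *: val u + sin (rho u v) *: val e.
Proof.
have sin_ge0 : 0 <= sin (rho u v) by rewrite sin_ge0_pi// rho_ge0 rho_lepi.
pose x := val v - cos (rho u v) *: val u.
have vE : val v = cos (rho u v) *: val u + x by rewrite addrC subrK.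
have xu : dotp (val u) x = 0 by rewrite !dotpE dotp_sphere cos_rho; lra.
have xx : dotp x x = sin (rho u v) ^+ 2.
  rewrite sin2cos2 !dotpE !dotp_sphere (dotpC (val v) (val u)) cos_rho; lra.
have [x0|x0] := eqVneq x 0.
  have [e eu] := sphere_orthogonal u; exists e; split => //.
  have /eqP : sin (rho u v) ^+ 2 = 0 by rewrite -xx x0 -(scale0r x) dotpZl mul0r.
  by rewrite sqrf_eq0 => /eqP ->; rewrite scale0r [LHS]vE x0.
have [e xE] := sphere_normalize x0.
move: xE; rewrite xx sqrtr_sqr ger0_norm// => xE.
exists e; split; last by rewrite -xE.
move: xu; rewrite xE dotpZr => /eqP; rewrite mulf_eq0 => /orP[|/eqP//].
by move=> /eqP s0; move: x0; rewrite xE s0 scale0r eqxx.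
Qed.

(** The point at distance [r] from [c] on a great circle through [c] and [u]; it
    makes distances to caps explicit. *)
Lemma sphere_geodesic c u (r : R) : 0 <= r <= rho c u ->
  exists p : sphere R m, rho c p = r /\ rho p u = rho c u - r.
Proof.
move=> /andP[r0 ru].
have [e [ce uE]] := sphere_polar c u.
have [|p pE] := @sphere_point (cos r *: val c + sin r *: val e).
  rewrite !dotpE !dotp_sphere (dotpC (val e)) ce.
  have := cos2Dsin2 r; lra.
have r_pi : r <= pi := le_trans ru (rho_lepi _ _).
have tpi := rho_lepi c u.
exists p; split.
- apply: rho_cosP; first by rewrite r0.
  by rewrite pE !dotpE dotp_sphere ce; lra.
- apply: rho_cosP; first by apply/andP; split; lra.
  rewrite pE uE cosB !dotpE !dotp_sphere (dotpC (val e)) ce; lra.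
Qed.

Lemma mirror_subproof w u :
  (val u - (2 * dotp (val u) (val w)) *: val w) \in @unit_sphere R m.
Proof.
apply/in_unit_sphere; rewrite !dotpE !dotp_sphere (dotpC (val w) (val u)); lra.
Qed.

(** The reflection in the hyperplane orthogonal to [w]. *)
Definition mirror w u : sphere R m :=
  exist (fun y => y \in @unit_sphere R m) _ (mirror_subproof w u).

Lemma val_mirror w u :
  val (mirror w u) = val u - (2 * dotp (val u) (val w)) *: val w.
Proof. by []. Qed.

Lemma dotp_mirror w u v :
  dotp (val (mirror w u)) (val v) =
  dotp (val u) (val v) - 2 * dotp (val u) (val w) * dotp (val v) (val w).
Proof. by rewrite val_mirror !dotpE (dotpC (val w) (val v)). Qed.

Lemma mirrorK w : involutive (mirror w).
Proof.
move=> u; apply: val_inj; rewrite /= !dotpE dotp_sphere -addrA -opprD -scalerDl.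
by rewrite [X in X *: _](_ : _ = 0) ?scale0r ?subr0//; lra.
Qed.

Lemma dotp_mirror2 w u v :
  dotp (val (mirror w u)) (val (mirror w v)) = dotp (val u) (val v).
Proof.
rewrite dotp_mirror (dotpC (val u)) !dotp_mirror dotp_sphere.
by rewrite (dotpC (val v) (val u)); lra.
Qed.

Lemma rho_mirror w u v : rho (mirror w u) v = rho u (mirror w v).
Proof. by rewrite !rhoE -(dotp_mirror2 w u) mirrorK. Qed.

Lemma rho_mirror2 w u v : rho (mirror w u) (mirror w v) = rho u v.
Proof. by rewrite rho_mirror mirrorK. Qed.

(** The mirror exchanging [u] and [v] has axis proportional to [u - v]; the points
    closer to [u] than to [v] form its positive side. *)
Lemma bisecting_reflection u v : u != v -> exists w : sphere R m,
  mirror w u = v /\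
  forall c, 0 < dotp (val c) (val u) - dotp (val c) (val v) ->
  0 < dotp (val c) (val w).
Proof.
move=> uv; have x0 : val u - val v != 0.
  by rewrite subr_eq0; apply: contra uv => /eqP/val_inj ->.
have [w wE] := sphere_normalize x0.
have := dotp_gt0 x0; set d := dotp _ _ in wE * => d0.
have dE : d = 2 - 2 * dotp (val u) (val v).
  by rewrite /d !dotpE !dotp_sphere (dotpC (val v)); lra.
have s0 : 0 < Num.sqrt d by rewrite sqrtr_gt0.
have cw c : Num.sqrt d * dotp (val c) (val w) =
    dotp (val c) (val u) - dotp (val c) (val v).
  by rewrite -dotpZr -wE !dotpE.
exists w; split; last by move=> c; rewrite -cw pmulr_rgt0.
apply: val_inj; rewrite val_mirror.
suff -> : 2 * dotp (val u) (val w) = Num.sqrt d.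
  by rewrite -wE opprB addrC subrK.
apply: (mulfI (lt0r_neq0 s0)).
by rewrite mulrCA cw -expr2 sqr_sqrtr ?ltW// dE dotp_sphere; lra.
Qed.

(** Products of two mirrors act transitively: [mirror u] sends [u] to [- u], and the
    mirror along the midpoint direction [h] of [u] and [v] sends [- u] to [v].  With
    polar coordinates, [h] makes sense even for antipodal points. *)
Lemma two_reflections u v : exists h, mirror h (mirror u u) = v.
Proof.
have [e [ue vE]] := sphere_polar u v.
pose t := rho u v / 2.
have [|h hE] := @sphere_point (cos t *: val u + sin t *: val e).
  rewrite !dotpE !dotp_sphere (dotpC (val e)) ue.
  have := cos2Dsin2 t; lra.
exists h; apply: val_inj; rewrite !val_mirror !dotpE dotp_sphere.
have tE : rho u v = t + t by rewrite /t; lra.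
rewrite vE tE cosD sinD hE !dotpE dotp_sphere ue.
apply/rowP => i; rewrite !mxE.
have := congr1 ( *%R^~ (val u ord0 i)) (cos2Dsin2 t); lra.
Qed.

Definition mirror_mx w : 'M[R]_m.+1 := 1%:M - 2 *: ((val w)^T *m val w).

Lemma mulmx_mirror_mx w x :
  x *m mirror_mx w = x - (2 * dotp x (val w)) *: val w.
Proof.
rewrite mulmxBr mulmx1 -scalemxAr mulmxA [x *m _]mx11_scalar mul_scalar_mx.
rewrite scalerA; congr (_ - (_ * _) *: _).
by rewrite mxE; apply: eq_bigr => i _; rewrite mxE.
Qed.

Lemma val_mirrorE w u : val (mirror w u) = val u *m mirror_mx w.
Proof. by rewrite mulmx_mirror_mx. Qed.

Lemma tr_mirror_mx w : (mirror_mx w)^T = mirror_mx w.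
Proof. by rewrite linearB linearZ /= trmx_mul trmxK trmx1. Qed.

Lemma mirror_mxK w : mirror_mx w *m mirror_mx w = 1%:M.
Proof.
apply/row_matrixP => i; rewrite row_mul row1 rowE !mulmx_mirror_mx.
set x := delta_mx _ _; rewrite !dotpE dotp_sphere -addrA -opprD -scalerDl.
by rewrite [X in X *: _](_ : _ = 0) ?scale0r ?subr0//; lra.
Qed.

Lemma mirror_mx_conj w (z : sphere R m) :
  mirror_mx (mirror z w) = mirror_mx z *m mirror_mx w *m mirror_mx z.
Proof.
rewrite {1}/mirror_mx val_mirrorE trmx_mul tr_mirror_mx.
rewrite [mirror_mx w]/mirror_mx (mulmxBr (mirror_mx z)) mulmx1.
rewrite (mulmxBl (mirror_mx z)) mirror_mxK.
by rewrite -scalemxAr -scalemxAl !mulmxA.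
Qed.

(** All mirrors are conjugate by mirrors, so their determinants agree; thus the
    determinant of a product of two mirrors is the determinant of the square of one
    of them, which is the identity. *)
Lemma det_mirror_mx2 w (z : sphere R m) : \det (mirror_mx w) = \det (mirror_mx z).
Proof.
have [<-//|wz] := eqVneq w z.
have [y [<- _]] := bisecting_reflection wz.
by rewrite mirror_mx_conj !det_mulmx mulrAC -det_mulmx mirror_mxK det1 mul1r.
Qed.

Lemma is_rotation_mirror2 w (z : sphere R m) : is_rotation (mirror w \o mirror z).
Proof.
exists (mirror_mx z *m mirror_mx w); split.
- by rewrite trmx_mul !tr_mirror_mx mulmxA -(mulmxA (mirror_mx z)) mirror_mxK
    mulmx1 mirror_mxK.
- by rewrite det_mulmx (det_mirror_mx2 z w) -det_mulmx mirror_mxK det1.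
- by move=> u; rewrite /= mulmxA -!val_mirrorE.
Qed.

End Geometry.

(** * Compactness and Lipschitz functions *)

Section Topology.
Context {R : realType} {m : nat}.
Implicit Types (u v w c : sphere R m) (F G : sphere R m -> R).

Lemma continuous_set_val : continuous (fun u : sphere R m => val u).
Proof. exact: (@initial_continuous _ _ (@set_val _ (@unit_sphere R m))). Qed.

Lemma continuous_dotp (x : 'rV[R]_m.+1) : continuous (dotp x).
Proof.
apply: continuous_big => [|i _]; first by move=> z; apply: add_continuous.
by move=> y; apply: continuousM; [exact: cst_continuous|exact: coord_continuous].
Qed.

Lemma open_rho_ball c (e : R) : 0 < e -> open [set v | rho c v < e].
Proof.
move=> e0; have [epi|epi] := ltP pi e.
  rewrite (_ : [set _ | _] = setT); first exact: openT.
  by apply/seteqP; split => // v _ /=; exact: le_lt_trans (rho_lepi _ _) epi.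
have -> : [set v | rho c v < e] =
    (fun v => dotp (val c) (val v)) @^-1` [set y | cos e < y].
  apply/seteqP; split => v /=;
    by rewrite -cos_rho ltr_cos ?rho_in// in_itv /= (ltW e0).
apply: open_comp; last exact: open_gt.
move=> v _; apply: continuous_comp; last exact: continuous_dotp.
exact: continuous_set_val.
Qed.

Lemma compact_unit_sphere : compact (@unit_sphere R m).
Proof.
apply: bounded_closed_compact.
  exists 1; split; first exact: num_real.
  move=> M M1 x /mem_set/in_unit_sphere xx /=; apply/(le_trans _ (ltW M1)).
  rewrite [leLHS]mx_normrE; apply/bigmax_leP; split => //= -[i j] _ /=.
  rewrite ord1 -(ler_pXn2r (n := 2))// ?nnegrE// real_normK ?num_real// expr1n.
  rewrite -xx /dotp (bigD1 j)//= -expr2 lerDl.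
  by apply: sumr_ge0 => k _; rewrite -expr2 sqr_ge0.
rewrite (_ : @unit_sphere R m = (fun x => dotp x x) @^-1` [set 1]); last first.
  by apply/seteqP; split => x /=; [move=> /mem_set/in_unit_sphere|
    move=> h; apply/set_mem/in_unit_sphere].
apply: closed_comp; last exact: closed_eq.
move=> x _; apply: continuous_big => [|i _]; first by move=> z; apply: add_continuous.
by move=> y; apply: continuousM; exact: coord_continuous.
Qed.

(** Compactness of the sphere in the ambient space, stated for the geodesic
    distance. *)
Lemma rho_net (e : R) : 0 < e ->
  exists s : seq (sphere R m), forall u, exists2 p, p \in s & rho p u < e.
Proof.
move=> e0; wlog epi : e e0 / e <= pi.
  move=> h; have [epi|/ltW epi] := leP e pi; first exact: h.
  have [s sP] := h pi (pi_gt0 _) (lexx _); exists s => u.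
  by have [p ps pu] := sP u; exists p => //; exact: lt_le_trans epi.
have := compact_unit_sphere; rewrite compact_cover.
move=> /(_ (sphere R m) setT (fun p => [set y | cos e < dotp (val p) y])).
have rhoP p u : (cos e < dotp (val p) (val u)) = (rho p u < e).
  by rewrite -cos_rho ltr_cos ?rho_in// in_itv /= (ltW e0).
case=> [p _|y /mem_set yS|s _ sP].
- apply: (@open_comp _ _ (dotp (val p)) [set t | cos e < t]).
    by move=> y _; exact: continuous_dotp.
  exact: open_gt.
- have [u <-] := sphere_point ((in_unit_sphere _).1 yS).
  by exists u => //=; rewrite rhoP rhoxx.
- exists (finmap.enum_fset s) => u; have /sP[p /= ps] := set_mem (valP u).
  by rewrite rhoP => pu; exists p.
Qed.

(** All integrands used below are Lipschitz: this class is stable under the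
    operations needed and makes measurability, boundedness and integrability
    automatic. *)
Definition rho_lipschitz F :=
  exists2 L : R, 0 <= L & forall u v, `|F u - F v| <= L * rho u v.

Lemma rho_lipschitz1 F : lip1 F -> rho_lipschitz F.
Proof. by move=> h; exists 1 => // u v; rewrite mul1r. Qed.

Lemma rho_lipschitz_cst (a : R) : rho_lipschitz (fun=> a).
Proof. by exists 0 => // u v; rewrite subrr normr0 mul0r. Qed.

Lemma rho_lipschitz_bounded F : rho_lipschitz F -> exists M, forall u, `|F u| <= M.
Proof.
move=> [L L0 FL]; exists (`|F point| + L * pi) => u.
rewrite -[F u](subrK (F point)) addrC (le_trans (ler_normD _ _))// lerD2l.
by rewrite (le_trans (FL _ _))// ler_wpM2l// rho_lepi.
Qed.

Lemma rho_lipschitzD F G : rho_lipschitz F -> rho_lipschitz G ->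
  rho_lipschitz (fun u => F u + G u).
Proof.
move=> [K K0 FK] [L L0 GL]; exists (K + L) => [|u v]; first exact: addr_ge0.
by rewrite opprD addrACA mulrDl (le_trans (ler_normD _ _))// lerD.
Qed.

Lemma rho_lipschitzM F G : rho_lipschitz F -> rho_lipschitz G ->
  rho_lipschitz (fun u => F u * G u).
Proof.
move=> lF lG; have [A FA] := rho_lipschitz_bounded lF.
have [B GB] := rho_lipschitz_bounded lG.
have A0 := le_trans (normr_ge0 _) (FA point).
have B0 := le_trans (normr_ge0 _) (GB point).
move: lF lG => [K K0 FK] [L L0 GL].
exists (A * L + B * K) => [|u v]; first by rewrite addr_ge0 ?mulr_ge0.
have -> : F u * G u - F v * G v = F u * (G u - G v) + G v * (F u - F v) by lra.
by rewrite (le_trans (ler_normD _ _))// !normrM mulrDl -!mulrA lerD ?ler_pM.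
Qed.

Lemma rho_lipschitz_comp (phi : R -> R) F (L : R) : 0 <= L ->
  (forall a b, `|phi a - phi b| <= L * `|a - b|) ->
  rho_lipschitz F -> rho_lipschitz (phi \o F).
Proof.
move=> L0 phiL [K K0 FK]; exists (L * K) => [|u v]; first exact: mulr_ge0.
by rewrite (le_trans (phiL _ _))// -mulrA ler_wpM2l.
Qed.

Lemma rho_lipschitzN F : rho_lipschitz F -> rho_lipschitz (fun u => - F u).
Proof.
apply: (@rho_lipschitz_comp -%R _ 1) => // a b.
by rewrite mul1r -opprD normrN.
Qed.

Lemma rho_lipschitz_mirror F w : rho_lipschitz F -> rho_lipschitz (F \o mirror w).
Proof. by move=> [L L0 FL]; exists L => // u v; rewrite -(rho_mirror2 w) FL. Qed.

Lemma rho_dist_lip c u v : `|rho c u - rho c v| <= rho u v.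
Proof.
have := rho_triangle c v u; have := rho_triangle c u v.
by rewrite (rhoC v u) ler_norml; lra.
Qed.

Lemma rho_lipschitz_rho c : rho_lipschitz (rho c).
Proof. by apply: rho_lipschitz1 => u v; exact: rho_dist_lip. Qed.

Lemma rho_lipschitz_continuous F : rho_lipschitz F -> continuous F.
Proof.
move=> [L L0 FL] u.
apply/(@cvgrPdist_lt _ _ _ (nbhs u) (nbhs_filter u)) => e e0.
have L1 : 0 < L + 1 by rewrite ltr_wpDl.
have eL : 0 < e / (L + 1) by exact: divr_gt0.
have : nbhs u [set v | rho u v < e / (L + 1)].
  by apply: open_nbhs_nbhs; split; [exact: open_rho_ball|rewrite /= rhoxx].
apply: filterS; move=> v /=; rewrite ltr_pdivlMr// => h; rewrite (le_lt_trans (FL _ _))//.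
by apply: le_lt_trans h; rewrite mulrC ler_wpM2l ?rho_ge0// lerDl.
Qed.

Lemma open_measurable_sphere (A : set (sphere R m)) : open A -> measurable A.
Proof. by move=> oA; exact: sub_sigma_algebra. Qed.

Lemma continuous_measurable_sphere F : continuous F -> measurable_fun setT F.
Proof.
move=> cF.
refine (@measurability _ _ _ _ setT F _ (RGenOInfty.measurableE R) _).
move=> _ [_ [x ->] <-].
rewrite setTI; apply: open_measurable_sphere; apply: open_comp => [u _|].
  exact: cF.
exact: rray_open.
Qed.

Lemma rho_lipschitz_measurable F : rho_lipschitz F -> measurable_fun setT F.
Proof. by move=> /rho_lipschitz_continuous/continuous_measurable_sphere. Qed.

Lemma rho_lipschitz_integrable (sigma : probability (sphere R m) R) F :
  rho_lipschitz F -> sigma.-integrable setT (EFin \o F).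
Proof.
move=> lF; apply: measurable_bounded_integrable => //.
- by apply: le_lt_trans (ltry 1); exact: (probability_le1 sigma measurableT).
- exact: rho_lipschitz_measurable.
have [M FM] := rho_lipschitz_bounded lF.
exists M; split; first exact: num_real.
by move=> N MN u _ /=; exact: le_trans (FM u) (ltW MN).
Qed.

End Topology.

(** * Means, balls and comparison of a mean with its mirror image *)

Section Invariance.
Context {R : realType} {m : nat}.
Hypothesis m_gt0 : (0 < m)%N.
Variable sigma : probability (sphere R m) R.
Hypothesis sigma_inv : rotation_invariant sigma.
Implicit Types (u v w c : sphere R m) (F G : sphere R m -> R).

Local Notation ball c e := [set v | rho c v < e].

Definition mean F : R := \int[sigma]_u F u.

Lemma mean_EFin F : rho_lipschitz F -> (\int[sigma]_u (F u)%:E)%E = (mean F)%:E.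
Proof.
move=> lF; rewrite /mean /Rintegral fineK//.
by apply: integrable_fin_num => //; exact: rho_lipschitz_integrable.
Qed.

Lemma eq_mean F G : F =1 G -> mean F = mean G.
Proof. by move=> FG; apply: eq_Rintegral => u _; exact: FG. Qed.

Lemma mean_cst (a : R) : mean (fun=> a) = a.
Proof. by rewrite /mean Rintegral_cst// [X in fine X](probability_setT sigma) mulr1. Qed.

Lemma meanD F G : rho_lipschitz F -> rho_lipschitz G ->
  mean (fun u => F u + G u) = mean F + mean G.
Proof. by move=> lF lG; rewrite /mean RintegralD//; exact: rho_lipschitz_integrable. Qed.

Lemma meanZ (a : R) F : rho_lipschitz F -> mean (fun u => a * F u) = a * mean F.
Proof. by move=> lF; rewrite /mean RintegralZl//; exact: rho_lipschitz_integrable. Qed.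

Lemma meanN F : rho_lipschitz F -> mean (fun u => - F u) = - mean F.
Proof.
by move=> lF; rewrite -mulN1r -meanZ//; apply: eq_mean => u; rewrite mulN1r.
Qed.

Lemma meanB F G : rho_lipschitz F -> rho_lipschitz G ->
  mean (fun u => F u - G u) = mean F - mean G.
Proof. by move=> lF lG; rewrite meanD ?meanN//; exact: rho_lipschitzN. Qed.

Lemma mean_le F G : rho_lipschitz F -> rho_lipschitz G ->
  (forall u, F u <= G u) -> mean F <= mean G.
Proof.
by move=> lF lG FG; apply: le_Rintegral => //; exact: rho_lipschitz_integrable.
Qed.

Lemma measurable_ball c (e : R) : 0 < e -> measurable (ball c e).
Proof. by move=> e0; apply: open_measurable_sphere; exact: open_rho_ball. Qed.

Lemma measure_ball u v (e : R) : 0 < e -> sigma (ball u e) = sigma (ball v e).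
Proof.
move=> e0; have [h <-] := two_reflections m_gt0 u v.
rewrite -[RHS](sigma_inv (is_rotation_mirror2 h u))//; last exact: measurable_ball.
congr (sigma _); apply/seteqP; split => z /=; by rewrite !rho_mirror2.
Qed.

(** Finitely many balls of radius [e] cover the sphere, and by homogeneity they all
    have the same measure, which cannot be zero. *)
Lemma measure_ball_gt0 c (e : R) : 0 < e -> (0 < sigma (ball c e))%E.
Proof.
move=> e0; rewrite lt0e measure_ge0 andbT; apply/eqP => ball0.
have [s sP] := rho_net (R := R) (m := m) e0.
have : sigma (\big[setU/set0]_(p <- s) ball p e) = 0.
  elim: s {sP} => [|p s IHs]; first by rewrite big_nil measure0.
  have mU : measurable (\big[setU/set0]_(q <- s) ball q e).
    by apply: bigsetU_measurable => q _; exact: measurable_ball.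
  rewrite big_cons measureU0; [|exact: measurable_ball|exact: mU|exact: IHs].
  exact: etrans (measure_ball p c e0) ball0.
have -> : \big[setU/set0]_(p <- s) ball p e = setT.
  apply/seteqP; split => // u _; have [p ps pu] := sP u.
  by rewrite -bigcup_seq; exists p.
by rewrite (probability_setT sigma) => /eqP; rewrite onee_eq0.
Qed.

(** By continuity [F] is at least [F u / 2] on a ball about [u]. *)
Lemma mean_gt0 F u : rho_lipschitz F -> (forall v, 0 <= F v) -> 0 < F u ->
  0 < mean F.
Proof.
move=> lF F0 Fu; have [L L0 FL] := lF.
pose a := F u / 2; have a0 : 0 < a by exact: divr_gt0.
pose e := a / (L + 1); have L1 : 0 < L + 1 by rewrite ltr_wpDl.
have e0 : 0 < e by exact: divr_gt0.
rewrite -lte_fin -mean_EFin//.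
have ge_a : (a%:E * sigma (ball u e) <= \int[sigma]_v (F v)%:E)%E.
  rewrite -(setIT (ball u e)) -integral_indic//; last exact: measurable_ball.
  rewrite -ge0_integralZl_EFin//; last exact: ltW.
    apply: ge0_le_integral => //.
    - by move=> v _; rewrite -EFinM lee_fin mulr_ge0// ltW.
    - apply/measurable_EFinP/measurable_funM => //.
      exact: (measurable_indic (measurable_ball _ e0)).
    - by apply/measurable_EFinP; exact: rho_lipschitz_measurable.
    - move=> v _; rewrite -EFinM lee_fin indicE.
      have [/set_mem /= uv|_] := boolP (v \in _); last by rewrite mulr0.
      rewrite mulr1; have := FL u v.
      have : L * rho u v <= a.
        move: uv; rewrite /e ltr_pdivlMr// => uv.
        by have := rho_ge0 u v; nra.
      rewrite /a ler_norml => ? ?; lra.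
  exact: ((measurable_EFinP _ _).2 (measurable_indic (measurable_ball _ e0))).
by apply: lt_le_trans ge_a; rewrite mule_gt0 ?lte_fin// measure_ball_gt0.
Qed.

(** The condition is [cos e < u . s v], and [u . s v] is a polynomial in the
    coordinates of [u] and [v], which are measurable for the product
    sigma-algebra. *)
Lemma measurable_rho_pairs w (e : R) : 0 < e <= pi ->
  measurable [set z : sphere R m * sphere R m | rho z.1 (mirror w z.2) < e].
Proof.
move=> /andP[e0 epi].
have mcoord (i : 'I_m.+1) : measurable_fun setT (fun u : sphere R m => val u ord0 i).
  apply: continuous_measurable_sphere => u.
  apply: (@continuous_comp _ _ _ (fun u : sphere R m => val u)
    (fun x : 'rV[R]_m.+1 => x ord0 i)).
    exact: continuous_set_val.
  exact: coord_continuous.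
have mdot (f g : sphere R m * sphere R m -> sphere R m) :
    measurable_fun setT f -> measurable_fun setT g ->
    measurable_fun setT (fun z => dotp (val (f z)) (val (g z))).
  move=> mf mg; apply: measurable_sum => i; apply: measurable_funM.
    exact: (measurableT_comp (mcoord i) mf).
  exact: (measurableT_comp (mcoord i) mg).
have mh : measurable_fun [set: sphere R m * sphere R m]
    (fun z => dotp (val z.1) (val (mirror w z.2))).
  rewrite (_ : (fun _ => _) = (fun z => dotp (val z.1) (val z.2) -
      2 * dotp (val z.2) (val w) * dotp (val z.1) (val w))); last first.
    by apply/funext => z; rewrite /= dotpC dotp_mirror (dotpC (val z.2) (val z.1)).
  apply: measurable_funB; first exact: mdot.
  apply: measurable_funM; last by apply: mdot => //; exact: measurable_cst.
  apply: measurable_funM => //; apply: mdot => //; exact: measurable_cst.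
rewrite (_ : [set _ | _] = setT `&`
  (fun z => dotp (val z.1) (val (mirror w z.2))) @^-1` `]cos e, +oo[); last first.
  rewrite setTI; apply/seteqP.
  have dotP z : (cos e < dotp (val z.1) (val (mirror w z.2))) =
      (rho z.1 (mirror w z.2) < e).
    by rewrite -cos_rho ltr_cos ?rho_in// in_itv /= (ltW e0).
  by split => z /=; rewrite in_itv /= andbT -dotP.
exact: mh.
Qed.

(** Let [c] be the measure of a ball of radius [e] and integrate [F u] over the pairs
    [(u, v)] with [rho u (s v) < e], where [s] is the mirror.  Integrating first in
    [v] gives [c * mean F], since the condition reads [rho (s u) v < e].  Integrating
    first in [u] gives at most [c * mean (F o s + L e)], since [F u] differs from
    [F (s v)] by at most [L e]. *)
Lemma mean_mirror_le w F (L e : R) : 0 <= L -> 0 < e <= pi ->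
  (forall u v, `|F u - F v| <= L * rho u v) -> (forall u, 0 <= F u) ->
  mean F <= mean (F \o mirror w) + L * e.
Proof.
move=> L0 /andP[e0 epi] FL F0.
have lF : rho_lipschitz F by exists L.
have lFw : rho_lipschitz (F \o mirror w) by exact: rho_lipschitz_mirror.
have mF := rho_lipschitz_measurable lF.
pose D := [set z : sphere R m * sphere R m | rho z.1 (mirror w z.2) < e].
have mD : measurable D by apply: measurable_rho_pairs; rewrite e0.
have secl u v : \1_D (u, v) = \1_(ball (mirror w u) e) v :> R.
  rewrite !indicE; congr (nat_of_bool _)%:R.
  by apply/idP/idP => /set_mem h; apply/mem_set; move: h; rewrite /D /= rho_mirror.
have secr u v : \1_D (u, v) = \1_(ball (mirror w v) e) u :> R.
  rewrite !indicE; congr (nat_of_bool _)%:R.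
  by apply/idP/idP => /set_mem h; apply/mem_set; move: h; rewrite /D /= rhoC.
pose c := fine (sigma (ball point e)).
have cE u : sigma (ball u e) = c%:E.
  by rewrite (measure_ball u point e0) fineK// fin_num_measure//; exact: measurable_ball.
have c0 : 0 < c by rewrite -lte_fin -(cE point) measure_ball_gt0.
have int_ball (a : R) u : 0 <= a ->
    (\int[sigma]_v (a * \1_(ball u e) v)%:E)%E = (a * c)%:E.
  move=> a0; under eq_integral do rewrite EFinM.
  rewrite ge0_integralZl_EFin//.
  - rewrite integral_indic ?setIT//; last exact: measurable_ball.
    exact: (congr1 (fun t => a%:E * t)%E (cE u)).
  - exact: ((measurable_EFinP _ _).2 (measurable_indic (measurable_ball _ e0))).
pose f (z : sphere R m * sphere R m) := (F z.1 * \1_D z)%:E.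
have f0 z : (0%R <= f z)%E by rewrite lee_fin mulr_ge0.
have mf : measurable_fun setT f.
  apply/measurable_EFinP/measurable_funM; last exact: measurable_indic.
  exact: (measurableT_comp mF measurable_fst).
have fubini : ((mean F * c)%:E = \int[sigma]_v \int[sigma]_u f (u, v))%E.
  rewrite -(fubini_tonelli (m1 := sigma) (m2 := sigma) f mf f0).
  transitivity (\int[sigma]_u (c * F u)%:E)%E.
    rewrite mean_EFin ?meanZ 1?mulrC//.
    exact: rho_lipschitzM (rho_lipschitz_cst _) lF.
  apply: eq_integral => u _; rewrite /f /= (mulrC c) -(int_ball _ (mirror w u))//.
  by apply: eq_integral => v _; rewrite secl.
have lG : rho_lipschitz (fun v => c * (F (mirror w v) + L * e)).
  apply: rho_lipschitzM (rho_lipschitz_cst _) _.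
  exact: rho_lipschitzD lFw (rho_lipschitz_cst _).
have : ((mean F * c)%:E <= \int[sigma]_v (c * (F (mirror w v) + L * e))%:E)%E.
  rewrite fubini; apply: ge0_le_integral => //.
  - by move=> v _; apply: integral_ge0.
  - exact: (measurable_fun_fubini_tonelli_G f mf f0).
  - exact: ((measurable_EFinP _ _).2 (rho_lipschitz_measurable lG)).
  - move=> v _; rewrite mulrC -(int_ball _ (mirror w v)); last first.
      by rewrite addr_ge0// mulr_ge0// ltW.
    apply: ge0_le_integral => //.
    + exact: (measurableT_comp mf (pair2_measurable v)).
    + apply/measurable_EFinP/measurable_funM => //.
      exact: (measurable_indic (measurable_ball _ e0)).
    + move=> u _; rewrite /f secr lee_fin indicE.
      have [/set_mem /= uv|_] := boolP (u \in _); last by rewrite !mulr0.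
      rewrite !mulr1; have := FL u (mirror w v).
      have : L * rho u (mirror w v) <= L * e by rewrite ler_wpM2l// rhoC ltW.
      rewrite ler_norml /=; lra.
rewrite mean_EFin// lee_fin meanZ; last first.
  exact: rho_lipschitzD lFw (rho_lipschitz_cst _).
by rewrite meanD// ?mean_cst ?[_ * c]mulrC ?ler_pM2l//; exact: rho_lipschitz_cst.
Qed.

End Invariance.

(** * Mirror invariance of the mean, and null points *)

Section Points.
Context {R : realType} {m : nat}.
Hypothesis m_gt0 : (0 < m)%N.
Variable sigma : probability (sphere R m) R.
Hypothesis sigma_inv : rotation_invariant sigma.
Implicit Types (u v w c : sphere R m) (F G : sphere R m -> R).
Local Notation mean := (mean sigma).

(** Let [e] tend to [0] in the previous inequality, after adding a constant that
    makes [F] nonnegative; the reverse inequality is the same one for [F o s]. *)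
Lemma mean_mirror w F : rho_lipschitz F -> mean (F \o mirror w) = mean F.
Proof.
have le_ge0 G : rho_lipschitz G -> (forall u, 0 <= G u) ->
    mean G <= mean (G \o mirror w).
  move=> [L L0 GL] G0; apply/ler_addgt0Pr => d d0.
  have L1 : 0 < L + 1 by rewrite ltr_wpDl.
  (* [L + 1] rather than [L], as [L] may vanish; radii above [pi] are excluded
     because [cos] is not monotone there. *)
  pose e := Num.min pi (d / (L + 1)).
  have e_gt0 : 0 < e by rewrite lt_min pi_gt0 divr_gt0.
  have := @mean_mirror_le _ _ m_gt0 _ sigma_inv w G L e L0 _ GL G0.
  rewrite e_gt0 ge_min lexx /= => /(_ isT) h; apply: (le_trans h).
  rewrite lerD2l (le_trans (ler_wpM2l L0 (_ : e <= d / (L + 1))))//.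
    by rewrite ge_min lexx orbT.
  by rewrite mulrA ler_pdivrMr//; nra.
have le G : rho_lipschitz G -> mean G <= mean (G \o mirror w).
  move=> lG; have [M GM] := rho_lipschitz_bounded lG.
  have lM := @rho_lipschitz_cst R m M.
  have := le_ge0 _ (rho_lipschitzD lG lM).
  rewrite meanD// (_ : _ \o _ = fun u => (G \o mirror w) u + M)//.
  rewrite meanD//; last exact: rho_lipschitz_mirror.
  rewrite lerD2r; apply => u; have := GM u; rewrite ler_norml; lra.
move=> lF; apply/eqP; rewrite eq_le le// andbT.
rewrite (le_trans (le _ (rho_lipschitz_mirror w lF)))//.
by rewrite (_ : _ \o _ = F)//; apply/funext => u /=; rewrite mirrorK.
Qed.

Lemma measurable_sphere_set1 u : measurable [set u].
Proof.
rewrite (_ : [set u] = \bigcap_k [set v | rho u v < k.+1%:R^-1]).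
  by apply: bigcapT_measurable => k; apply: measurable_ball; rewrite invr_gt0.
apply/seteqP; split => [_ -> k _ /=|v vu]; first by rewrite rhoxx invr_gt0.
apply/esym/rho_eq0/ler_addgt0Pr => e e0; rewrite add0r.
have [k ke] := ltr_add_invr e0; rewrite add0r in ke.
exact: ltW (lt_trans (vu k _) ke).
Qed.

(** All points have the same measure and there are infinitely many of them. *)
Lemma measure_sphere_set1 u : sigma [set u] = 0%E.
Proof.
have set1E v : sigma [set v] = sigma [set u].
  have [h hE] := two_reflections m_gt0 u v.
  rewrite -(sigma_inv (is_rotation_mirror2 h u))//; last first.
    exact: measurable_sphere_set1.
  congr (sigma _); apply/seteqP; split => z /=.
    by rewrite -hE => /(can_inj (mirrorK h))/(can_inj (mirrorK u)).
  by move=> ->.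
(* Distinct points, at distances [1 / (k + 1)] from [u]. *)
have /boolp.choice[p pP] (k : nat) : exists v, rho u v = k.+1%:R^-1.
  have [e ue] := sphere_orthogonal m_gt0 u.
  have re : rho u e = pi / 2 by rewrite rhoE ue acos0.
  have [|v [uv _]] := @sphere_geodesic _ _ m_gt0 u e (k.+1%:R^-1).
    rewrite re invr_ge0 ler0n /= (@le_trans _ _ 1)//.
      by rewrite invf_le1// ler1n.
    by have := @pihalf_ge1 R.
  by exists v.
have p_inj k l : p k = p l -> k = l.
  move=> pkl; have := pP k; rewrite pkl pP => /invr_inj/eqP.
  by rewrite eqr_nat => /eqP[].
pose A N := \big[setU/set0]_(k < N) [set p k].
have mA N : measurable (A N).
  by apply: bigsetU_measurable => k _; exact: measurable_sphere_set1.
pose a := fine (sigma [set u]).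
have aE : sigma [set u] = a%:E.
  by rewrite fineK// fin_num_measure//; exact: measurable_sphere_set1.
have AE N : sigma (A N) = (N%:R * a)%:E.
  elim: N => [|N IHN]; first by rewrite /A big_ord0 measure0 mul0r.
  have -> : sigma (A N.+1) = (sigma (A N) + sigma [set p N])%E.
    rewrite {1}/A big_ord_recr; apply: measureU; first exact: mA.
      exact: measurable_sphere_set1.
    apply/seteqP; split => // z [+ /= zE].
    rewrite /A -(bigcup_mkord N (fun k => [set p k])) => -[k /= kN].
    by rewrite zE => /p_inj kE; rewrite kE ltnn in kN.
  by rewrite IHN set1E aE -EFinD -natr1 mulrDl mul1r.
rewrite aE; apply/eqP; rewrite eqe; apply/eqP/le_anti/andP; split; last first.
  by rewrite -lee_fin -aE measure_ge0.
rewrite leNgt; apply/negP => a0.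
have := probability_le1 sigma (mA (Num.truncn a^-1).+1).
rewrite AE lee_fin leNgt => /negP; apply.
by rewrite -ltr_pdivrMr// div1r truncnS_gt.
Qed.

End Points.

(** * Polarization *)

Section Polarization.
Context {R : realType} {m : nat}.
Hypothesis m_gt0 : (0 < m)%N.
Variable sigma : probability (sphere R m) R.
Hypothesis sigma_inv : rotation_invariant sigma.
Implicit Types (u v w c : sphere R m) (f g : sphere R m -> R).
Local Notation mean := (mean sigma).

(** The two-point rearrangement: on each pair exchanged by the mirror, the larger
    value goes to the side containing [w]. *)
Definition polarize w g u : R :=
  if 0 <= dotp (val u) (val w) then Num.max (g u) (g (mirror w u))
  else Num.min (g u) (g (mirror w u)).

Lemma dotp_mirror_self w u :
  dotp (val (mirror w u)) (val w) = - dotp (val u) (val w).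
Proof. by rewrite dotp_mirror dotp_sphere; lra. Qed.

Lemma mirror_id w u : dotp (val u) (val w) = 0 -> mirror w u = u.
Proof. by move=> uw; apply: val_inj; rewrite val_mirror uw mulr0 scale0r subr0. Qed.

(** If [u] and [v] are on opposite sides of the mirror, then [mirror w v] is at least
    as close to [u] as [v] is, so all four differences of values are at most
    [rho u v]. *)
Lemma polarize_lip1 w g : lip1 g -> lip1 (polarize w g).
Proof.
move=> gL u v.
have uv := gL u v.
have smsm := gL (mirror w u) (mirror w v); rewrite rho_mirror2 in smsm.
have usv := gL u (mirror w v); have suv := gL (mirror w u) v.
rewrite rho_mirror in suv.
have closer : (0 <= dotp (val u) (val w)) != (0 <= dotp (val v) (val w)) ->
    rho u (mirror w v) <= rho u v.
  move=> opp; rewrite rho_le (dotpC (val u) (val (mirror w v))) dotp_mirror.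
  rewrite (dotpC (val v) (val u)).
  suff : dotp (val v) (val w) * dotp (val u) (val w) <= 0 by lra.
  move: opp; case: leP => ?; case: leP => ? // _; nra.
move: closer; rewrite /polarize !ler_norml; move: uv smsm usv suv.
rewrite !ler_norml; case: (0 <= _); case: (0 <= _) => /=;
  (do 4 move=> /andP[? ?]); move=> closer; rewrite ?maxEle ?minEle;
  (have [] := leP (g u) (g (mirror w u)); have [] := leP (g v) (g (mirror w v)));
  move=> ? ?; try (have := closer isT); lra.
Qed.

(** On a pair exchanged by the mirror, polarization only permutes the two values. *)
Lemma polarize_pair (phi : R -> R) w g u :
  phi (polarize w g u) + phi (polarize w g (mirror w u)) =
  phi (g u) + phi (g (mirror w u)).
Proof.
rewrite /polarize dotp_mirror_self mirrorK oppr_ge0.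
have [uw|uw|uw] := ltgtP (dotp (val u) (val w)) 0.
- by case: (leP (g u)) => // _; rewrite addrC.
- by case: (leP (g u)) => // _; rewrite addrC.
- by rewrite (mirror_id uw) maxxx.
Qed.

(** Average the identity for pairs, using that the mean is mirror invariant. *)
Lemma mean_polarize (phi : R -> R) (L : R) w g : 0 <= L ->
  (forall a b, `|phi a - phi b| <= L * `|a - b|) ->
  lip1 g ->
  mean (phi \o polarize w g) = mean (phi \o g).
Proof.
move=> L0 phiL gL.
have lp : rho_lipschitz (phi \o polarize w g).
  by apply: rho_lipschitz_comp L0 phiL _; exact/rho_lipschitz1/polarize_lip1.
have lg : rho_lipschitz (phi \o g).
  by apply: rho_lipschitz_comp L0 phiL _; exact/rho_lipschitz1.
have : mean (fun u => (phi \o polarize w g) u + (phi \o polarize w g \o mirror w) u) =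
       mean (fun u => (phi \o g) u + (phi \o g \o mirror w) u).
  by apply: eq_mean => u /=; exact: polarize_pair.
rewrite !meanD ?mean_mirror//; try exact: rho_lipschitz_mirror.
lra.
Qed.

(** Averaged over a pair, the loss is [(polarize w g v - g v)] times
    [(rho c (mirror w v) - rho c v)] up to a factor [2].  Both factors are
    nonnegative when [v] is on the side of [w], nonpositive otherwise, and positive at
    [u]; so the loss has positive mean. *)
Lemma polarize_decreases c u w g : lip1 g ->
  0 < dotp (val c) (val w) -> 0 < dotp (val u) (val w) -> g u < g (mirror w u) ->
  mean (fun v => rho c v * polarize w g v) < mean (fun v => rho c v * g v).
Proof.
move=> gL cw uw gu.
have lr := rho_lipschitz_rho c.
have lg := rho_lipschitz1 gL; have lp := rho_lipschitz1 (polarize_lip1 w gL).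
pose F v := rho c v * g v - rho c v * polarize w g v.
have lF : rho_lipschitz F.
  by apply: rho_lipschitzD (rho_lipschitzN _); exact: rho_lipschitzM.
have lFw := rho_lipschitz_mirror w lF.
have FE v : F v + F (mirror w v) =
    (polarize w g v - g v) * (rho c (mirror w v) - rho c v).
  have := polarize_pair id w g v; rewrite /F /= => h.
  have -> : g (mirror w v) = polarize w g v + polarize w g (mirror w v) - g v by lra.
  lra.
have rho_cmp v : (rho c v <= rho c (mirror w v)) = (0 <= dotp (val v) (val w)).
  rewrite rho_le (dotpC _ (val (mirror w v))) dotp_mirror (dotpC (val v) (val c)).
  by apply/idP/idP; nra.
have F0 v : 0 <= F v + F (mirror w v).
  rewrite FE /polarize -rho_cmp.
  have [h|h] := leP (rho c v) (rho c (mirror w v)); last rewrite -mulrNN.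
    by rewrite mulr_ge0// subr_ge0// le_max lexx.
  by rewrite mulr_ge0// opprB subr_ge0 ?(ltW h)// ge_min lexx.
have Fu : 0 < F u + F (mirror w u).
  rewrite FE /polarize (ltW uw) mulr_gt0// subr_gt0.
    by rewrite lt_max gu orbT.
  rewrite rho_lt (dotpC _ (val (mirror w u))) dotp_mirror (dotpC (val u) (val c)).
  by nra.
have := mean_gt0 m_gt0 sigma_inv (rho_lipschitzD lF lFw) F0 Fu.
rewrite meanD// (mean_mirror m_gt0 sigma_inv)// /F meanB; last 2 first.
  exact: rho_lipschitzM.
  exact: rho_lipschitzM.
lra.
Qed.

End Polarization.

(** * Radial rearrangement by minimization *)

Section Minimizer.
Context {R : realType} {m : nat}.
Hypothesis m_gt0 : (0 < m)%N.
Variable sigma : probability (sphere R m) R.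
Hypothesis sigma_inv : rotation_invariant sigma.
Implicit Types (u v w c : sphere R m) (f g : sphere R m -> R).
Local Notation mean := (mean sigma).

(** In a compact interval an ultrafilter converges to each of its cluster points. *)
Lemma ultra_bounded_cvg (U : set_system nat) (a : nat -> R) (M : R) :
  UltraFilter U -> (forall n, `|a n| <= M) ->
  exists y, forall e, 0 < e -> U [set n | `|a n - y| < e].
Proof.
move=> UU aM.
have UP : ProperFilter (a @ U) by apply: fmap_proper_filter.
have [|y [_ clu]] := @segment_compact R (- M) M (a @ U) UP.
  have aU : U (a @^-1` `[- M, M]).
    by apply: filterS filterT => n _; rewrite /preimage /= in_itv /= -ler_norml.
  exact: aU.
exists y => e e0; have [//|UC] := in_ultra_setVsetC [set n | `|a n - y| < e] UU.
have [||z [/= zC zy]] := clu [set x | ~ `|x - y| < e] (ball y e).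
- exact: UC.
- exact: nbhsx_ballx.
- by move: zy; rewrite -ball_normE /= distrC.
Qed.

(** A form of Arzela-Ascoli: pointwise limits along an ultrafilter are uniform on a
    finite net, and the Lipschitz condition extends this to the whole sphere. *)
Lemma lip1_cluster (g_ : nat -> sphere R m -> R) (M : R) :
  (forall n u v, `|g_ n u - g_ n v| <= rho u v) ->
  (forall n u, `|g_ n u| <= M) ->
  exists2 g, lip1 g &
    forall e N, 0 < e -> exists2 n, (N <= n)%N & forall u, `|g_ n u - g u| <= e.
Proof.
move=> gL gM.
have [U [UU sU]] := ultraFilterLemma eventually_filter.
have /boolp.choice[g gP] u := ultra_bounded_cvg UU (gM^~ u).
have gl u v : `|g u - g v| <= rho u v.
  apply/ler_addgt0Pr => e e0; have e2 : 0 < e / 2 by exact: divr_gt0.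
  have [n [nu nv]] := filter_ex (filterI (gP u _ e2) (gP v _ e2)).
  move: nu nv (gL n u v); rewrite /= !ltr_norml !ler_norml.
  by do 3 move=> /andP[? ?]; lra.
exists g => // e N e0; have e4 : 0 < e / 4 by exact: divr_gt0.
have [s sP] := rho_net (R := R) (m := m) e4.
(* Three errors of [e / 4] add up on the way from [u] to a nearby point of the net. *)
have Us : U [set n | forall p, p \in s -> `|g_ n p - g p| < e / 4].
  elim: s {sP} => [|p s IHs]; first by apply: filterS filterT => n _ p.
  apply: filterS (filterI IHs (gP p _ e4)) => n [/= ns np] q.
  by rewrite inE => /orP[/eqP ->|/ns].
have UN : U [set n | (N <= n)%N] by apply: sU; exists N.
have [n [/= Nn nP]] := filter_ex (filterI UN Us).
exists n => // u; have [p /nP np pu] := sP u.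
move: np pu (gL n p u) (gl p u); rewrite ltr_norml !ler_norml.
by move=> /andP[? ?] ? /andP[? ?] /andP[? ?]; lra.
Qed.

(** Equality of distributions is tested on Lipschitz functions [phi] only: this
    passes to uniform limits and involves only means of Lipschitz functions, to which
    mirror invariance applies. *)
Definition equimeasurable_lip1 f : set (sphere R m -> R) :=
  [set g | lip1 g /\
    forall (phi : R -> R) (L : R), 0 <= L ->
      (forall a b, `|phi a - phi b| <= L * `|a - b|) ->
      mean (phi \o g) = mean (phi \o f)].

Lemma equimeasurable_mean f g : equimeasurable_lip1 f g -> mean g = mean f.
Proof.
by move=> [_ /(_ id 1 ler01)]; apply => a b; rewrite mul1r.
Qed.

Lemma mean_dist_le f g (d : R) : rho_lipschitz f -> rho_lipschitz g ->
  (forall u, `|f u - g u| <= d) -> `|mean f - mean g| <= d.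
Proof.
move=> lf lg fg; rewrite -meanB//.
have lB : rho_lipschitz (fun u => f u - g u) by apply/rho_lipschitzD/rho_lipschitzN.
have fgN u : - d <= f u - g u <= d by rewrite -ler_norml.
have := mean_le sigma (rho_lipschitz_cst (- d)) lB (fun u => (andP (fgN u)).1).
have := mean_le sigma lB (rho_lipschitz_cst d) (fun u => (andP (fgN u)).2).
by rewrite !mean_cst ler_norml => -> ->.
Qed.

Lemma lip1_dist_mean g : lip1 g ->
  forall u, `|g u - mean g| <= pi.
Proof.
move=> gL u; rewrite -{1}(mean_cst sigma (g u)).
apply: mean_dist_le => [||v].
- exact: rho_lipschitz_cst.
- exact: rho_lipschitz1.
- exact: le_trans (gL _ _) (rho_lepi _ _).
Qed.

(** A cluster point of a minimizing sequence, for the uniform distance. *)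
Lemma equimeasurable_minimizer c f : lip1 f ->
  exists2 g, equimeasurable_lip1 f g & forall h, equimeasurable_lip1 f h ->
    mean (fun u => rho c u * g u) <= mean (fun u => rho c u * h u).
Proof.
move=> fL; pose J g := mean (fun u => rho c u * g u).
have lr := rho_lipschitz_rho c.
have J_lip g h (d : R) : equimeasurable_lip1 f g ->
    lip1 h ->
    (forall u, `|g u - h u| <= d) -> `|J g - J h| <= pi * d.
  move=> [gL _] hL gh; apply: mean_dist_le => [||u].
  - exact/rho_lipschitzM/rho_lipschitz1.
  - exact/rho_lipschitzM/rho_lipschitz1.
  - by rewrite -mulrBr normrM ler_pM// ger0_norm ?rho_ge0// rho_lepi.
pose M := `|mean f| + pi.
have KM g : equimeasurable_lip1 f g -> forall u, `|g u| <= M.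
  move=> Kg u; have := lip1_dist_mean Kg.1 u.
  rewrite (equimeasurable_mean Kg) => h.
  by rewrite -[g u](subrK (mean f)) addrC (le_trans (ler_normD _ _))// lerD2l.
pose A := [set J g | g in equimeasurable_lip1 f].
have A_inf : has_inf A.
  split; first by exists (J f), f.
  exists (- (pi * M)) => _ [g Kg <-].
  have z : `|J g - J (fun=> 0)| <= pi * M.
    apply: J_lip => // [u v|u]; first by rewrite subrr normr0 rho_ge0.
    by rewrite subr0 KM.
  have J0 : J (fun=> 0) = 0.
    by rewrite -[RHS](mean_cst sigma); apply: eq_mean => u; rewrite mulr0.
  by move: z; rewrite J0 subr0 ler_norml => /andP[].
have /boolp.choice[g_ g_P] (n : nat) : exists g, equimeasurable_lip1 f g /\
    J g < inf A + n.+1%:R^-1.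
  have [|_ [g Kg <-] Jg] := @inf_adherent _ A n.+1%:R^-1 _ A_inf.
    by rewrite invr_gt0.
  by exists g.
have [g gL g_cl] := lip1_cluster (fun n => (g_P n).1.1) (fun n => KM _ (g_P n).1).
have Kg : equimeasurable_lip1 f g.
  split=> // phi L L0 phiL; apply/subr0_eq/normr0_eq0/le_anti.
  rewrite normr_ge0 andbT; apply/ler_addgt0Pr => e e0; rewrite add0r.
  have L1 : 0 < L + 1 by rewrite ltr_wpDl.
  have [n _ gn] := g_cl (e / (L + 1)) 0%N (divr_gt0 e0 L1).
  rewrite -((g_P n).1.2 phi L)// distrC.
  apply: mean_dist_le => [||u].
  - exact/(rho_lipschitz_comp L0 phiL)/rho_lipschitz1/(g_P n).1.1.
  - exact/(rho_lipschitz_comp L0 phiL)/rho_lipschitz1.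
  - rewrite (le_trans (phiL _ _))// (le_trans (ler_wpM2l L0 (gn u)))//.
    by rewrite mulrA ler_pdivrMr//; nra.
exists g => // h Kh; apply: (@le_trans _ _ (inf A)); last first.
  by apply: ge_inf; [exact: A_inf.2|exists h].
apply/ler_addgt0Pr => e e0.
have pi0 := @pi_gt0 R.
have e2 : 0 < e / 2 by exact: divr_gt0.
have [N] := ltr_add_invr e2; rewrite add0r => Ne.
have [n Nn gn] := g_cl (e / 2 / pi) N (divr_gt0 e2 pi0).
have := J_lip _ _ _ (g_P n).1 gL gn; rewrite mulrC divfK ?gt_eqF// ler_norml.
move=> /andP[? ?].
have : J (g_ n) < inf A + e / 2.
  rewrite (lt_le_trans (g_P n).2)// lerD2l (le_trans _ (ltW Ne))//.
  by rewrite lef_pV2 ?posrE// ler_nat ltnS.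
rewrite -/(J g); lra.
Qed.

(** If the minimizer violated monotonicity at [u] and [v], polarizing it with respect
    to the mirror exchanging them would strictly decrease the functional. *)
Lemma radial_rearrangement c f : lip1 f ->
  exists2 g, equimeasurable_lip1 f g &
    forall u v, rho c u < rho c v -> g v <= g u.
Proof.
move=> fL; have [g Kg g_min] := equimeasurable_minimizer c fL.
exists g => // u v cuv; rewrite leNgt; apply/negP => guv.
have uv : u != v by apply: contraTneq cuv => ->; rewrite ltxx.
have [w [wu wE]] := bisecting_reflection uv.
rewrite rho_lt in cuv.
have cw : 0 < dotp (val c) (val w) by apply: wE; rewrite subr_gt0.
have uw : 0 < dotp (val u) (val w).
  by apply: wE; rewrite subr_gt0 -rho_lt rhoxx lt0r rho_ge0 andbT;
    apply: contra uv => /eqP uv0; apply/eqP/rho_eq0; rewrite uv0.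
have := polarize_decreases m_gt0 sigma_inv Kg.1 cw uw.
rewrite wu => /(_ guv); rewrite ltNge => /negP; apply; apply: g_min; split.
  exact: polarize_lip1 Kg.1.
move=> phi L L0 phiL; rewrite (mean_polarize m_gt0 sigma_inv w L0 phiL Kg.1).
exact: Kg.2 L0 phiL.
Qed.

End Minimizer.

(** * Caps *)

Section Caps.
Context {R : realType} {m : nat}.
Hypothesis m_gt0 : (0 < m)%N.
Variable sigma : probability (sphere R m) R.
Hypothesis sigma_inv : rotation_invariant sigma.
Implicit Types (u v w c : sphere R m) (f g : sphere R m -> R).
Local Notation mean := (mean sigma).
Local Notation cap c r := [set u | (rho c u <= r)%R].

(** The distance from [u] to the cap of radius [r] about [c], in closed form; see
    [rho_set_cap]. *)
Definition cap_dist c (r : R) u : R := Num.max 0 (rho c u - r).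

(** The lower bound is the triangle inequality; it is attained at [u] itself or at
    the point of a geodesic from [c] to [u] lying on the boundary of the cap. *)
Lemma rho_set_cap c (r : R) u : 0 <= r -> rho_set (cap c r) u = cap_dist c r u.
Proof.
move=> r0; have ge a : rho c a <= r -> cap_dist c r u <= rho a u.
  move=> ca; rewrite ge_max rho_ge0 /=.
  by have := rho_triangle c a u; lra.
have lbd : lbound [set rho a u | a in cap c r] (cap_dist c r u).
  by move=> _ [a ca <-]; exact: ge.
have att : [set rho a u | a in cap c r] (cap_dist c r u).
  rewrite /cap_dist; have [ur|ru] := leP (rho c u) r.
    by exists u => //; rewrite rhoxx max_l// subr_le0.
  have [|p [cp pu]] := @sphere_geodesic _ _ m_gt0 c u r; first by rewrite r0 ltW.
  by exists p; rewrite /= ?cp// pu max_r// subr_ge0 ltW.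
apply/le_anti/andP; split; first by apply: ge_inf => //; exists (cap_dist c r u).
by apply: lb_le_inf => //; exists (cap_dist c r u).
Qed.

Lemma cap_dist_lip1 c (r : R) u v : `|cap_dist c r u - cap_dist c r v| <= rho u v.
Proof.
have := rho_dist_lip c u v; rewrite /cap_dist !ler_norml => /andP[? ?].
by have := rho_ge0 u v; case: (leP 0 (rho c u - r)); case: (leP 0 (rho c v - r)); lra.
Qed.

Lemma measurable_superlevel f (t : R) : rho_lipschitz f ->
  measurable [set u | t <= f u].
Proof.
move=> lf; rewrite -[X in measurable X]setTI.
rewrite (_ : [set u | t <= f u] = f @^-1` `[t, +oo[); last first.
  by apply/seteqP; split => u /=; rewrite in_itv /= andbT.
exact: rho_lipschitz_measurable.
Qed.

Lemma measurable_cap c (r : R) : measurable (cap c r).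
Proof.
rewrite (_ : cap c r = [set u | - r <= - rho c u]).
  exact: (measurable_superlevel _ (rho_lipschitzN (rho_lipschitz_rho c))).
by apply/seteqP; split => u /=; rewrite lerN2.
Qed.

Lemma measure_le_mean f (A : set (sphere R m)) : rho_lipschitz f ->
  measurable A -> (forall u, \1_A u <= f u) -> (sigma A <= (mean f)%:E)%E.
Proof.
move=> lf mA Af; rewrite -mean_EFin// -[X in sigma X]setIT -integral_indic//.
apply: ge0_le_integral => //.
- exact: ((measurable_EFinP _ _).2 (measurable_indic mA)).
- exact: ((measurable_EFinP _ _).2 (rho_lipschitz_measurable lf)).
- by move=> u _; rewrite lee_fin.
Qed.

Lemma mean_le_measure f (A : set (sphere R m)) : rho_lipschitz f ->
  measurable A -> (forall u, 0 <= f u <= \1_A u) -> ((mean f)%:E <= sigma A)%E.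
Proof.
move=> lf mA Af; rewrite -mean_EFin// -[X in sigma X]setIT -integral_indic//.
apply: ge0_le_integral => //.
- by move=> u _; rewrite lee_fin; have /andP[] := Af u.
- exact: ((measurable_EFinP _ _).2 (rho_lipschitz_measurable lf)).
- exact: ((measurable_EFinP _ _).2 (measurable_indic mA)).
- by move=> u _; rewrite lee_fin; have /andP[] := Af u.
Qed.

(** A Lipschitz approximation from above of the indicator of the half-line [y >= t],
    exact outside [t - 1 / L < y < t]. *)
Definition ramp (t L y : R) : R := Num.min 1 (Num.max 0 (1 - L * (t - y))).

Lemma ramp_lip (t L a b : R) : 0 <= L -> `|ramp t L a - ramp t L b| <= L * `|a - b|.
Proof.
move=> L0; rewrite -[L in leRHS]ger0_norm// -normrM.
have : L * (a - b) = (1 - L * (t - a)) - (1 - L * (t - b)) by lra.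
rewrite /ramp; move: (1 - L * (t - a)) (1 - L * (t - b)) => p q ->.
have h1 := ler_norm (p - q); have h2 := ler_norm (- (p - q)); rewrite normrN in h2.
rewrite ler_norml; move: h1 h2; set d := `|p - q|.
case: (leP 0 p) => ?; case: (leP 0 q) => ? ? ?; rewrite ?(min_r ler01);
  case: (leP 1 p) => ?; case: (leP 1 q) => ?; apply/andP; split; lra.
Qed.

(** For ramps of slope [k + 1], [sigma {f >= t} <= mean (ramp o f) = mean (ramp o g)]
    and the last mean is at most [sigma {g >= t - 1 / (k + 1)}], which decreases to
    [sigma {g >= t}]. *)
Lemma measure_superlevel_le f g (t : R) : lip1 f ->
  equimeasurable_lip1 sigma f g ->
  (sigma [set u | (t <= f u)%R] <= sigma [set u | (t <= g u)%R])%E.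
Proof.
move=> fL [gL Kg].
have lf := rho_lipschitz1 fL; have lg := rho_lipschitz1 gL.
pose F k := [set u | t - k.+1%:R^-1 <= g u].
have mF k : measurable (F k) by exact: measurable_superlevel.
have FE : \bigcap_k F k = [set u | t <= g u].
  apply/seteqP; split => [u ut|u /= tu k _]; last first.
    by rewrite /F /= (le_trans _ tu)// gerBl.
  apply/ler_addgt0Pr => e e0.
  have [k ke] := ltr_add_invr e0; rewrite add0r in ke.
  by have := ut k Logic.I; rewrite /F /= lerBlDr => /le_trans; apply; rewrite lerD2l ltW.
have le_F k : (sigma [set u | (t <= f u)%R] <= sigma (F k))%E.
  have phiL a b := @ramp_lip t k.+1%:R a b (ler0n _ _).
  apply: (@le_trans _ _ (mean (ramp t k.+1%:R \o f))%:E).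
    apply: measure_le_mean; first exact: (rho_lipschitz_comp (ler0n _ _) phiL).
      exact: measurable_superlevel.
    move=> u; rewrite indicE /ramp /=; case: (boolP (u \in _)) => [/set_mem /= tu|_].
      rewrite le_min lexx le_max; apply/orP; right.
      by rewrite lerDl -mulrN mulr_ge0// opprB subr_ge0.
    by rewrite le_min ler01 le_max lexx.
  rewrite -(Kg _ _ (ler0n _ _) phiL).
  apply: mean_le_measure; [exact: (rho_lipschitz_comp (ler0n _ _) phiL)|exact: mF|].
  move=> u; rewrite indicE /ramp /= le_min ler01 le_max lexx /=.
  case: (boolP (u \in _)) => [_|/negP uF]; first by rewrite ge_min lexx.
  rewrite ge_min ge_max lexx /=; apply/orP; right.
  rewrite leNgt; apply/negP => h; apply: uF; apply/mem_set; rewrite /F /=.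
  have k0 : 0 < k.+1%:R :> R by [].
  by rewrite lerBlDr -lerBlDl -[leRHS]mul1r ler_pdivlMr// mulrC; lra.
have cvgF : sigma (F k) @[k --> \oo] --> sigma (\bigcap_k F k).
  apply: nonincreasing_cvg_mu => //.
  - by apply: le_lt_trans (ltry 1); exact: (probability_le1 sigma (mF 0%N)).
  - by apply: bigcapT_measurable.
  - move=> k l kl; apply/subsetPset => u; rewrite /F /=; apply: le_trans.
    by rewrite lerD2l lerN2 lef_pV2 ?posrE// ler_nat ltnS.
rewrite -FE -(cvg_lim _ cvgF)//; apply: lime_ge; first by apply/cvg_ex; eexists; exact: cvgF.
exact: nearW.
Qed.

(** Let [B] be the superlevel set of the radial rearrangement [g] of [f], and let [r]
    be the supremum of [rho c] on [B].  Then [B] is contained in the cap of radius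
    [r], which forces [r > 0] as points are null, and contains every cap of radius
    [r' < r] by monotonicity.  Hence [t <= g + cap_dist c r'] everywhere, where
    [t = x + mean f]; take means. *)
Lemma cap_dominates c f (x : R) : lip1 f ->
  (0 < sigma [set u | (x <= f u - mean f)%R])%E ->
  exists r : R, [/\ 0 < r, (sigma [set u | (x <= f u - mean f)%R] <= sigma (cap c r))%E &
    forall r', 0 < r' < r -> x <= mean (cap_dist c r')].
Proof.
move=> fL; pose t := x + mean f.
rewrite (_ : [set u | _] = [set u | t <= f u]); last first.
  by apply/seteqP; split => u /=; rewrite lerBrDr.
move=> A0; have [g Kg g_mono] := radial_rearrangement m_gt0 sigma_inv c fL.
have AB := measure_superlevel_le t fL Kg.
pose B := [set u | t <= g u]; rewrite -/B in AB.
have mB : measurable B := measurable_superlevel t (rho_lipschitz1 Kg.1).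
have B0 : B !=set0.
  by apply/set0P/eqP => B0; move: (lt_le_trans A0 AB); rewrite B0 measure0 ltxx.
pose D := [set rho c u | u in B].
have supD : has_sup D.
  split; first by have [u Bu] := B0; exists (rho c u), u.
  by exists pi => _ [u _ <-]; exact: rho_lepi.
have B_cap : B `<=` cap c (sup D).
  by move=> u Bu; apply: ub_le_sup; [exact: supD.2|exists u].
exists (sup D); split.
- rewrite ltNge; apply/negP => D0.
  have : (sigma B <= sigma [set c])%E.
    apply: le_measure; rewrite ?inE//; first exact: measurable_sphere_set1.
    by move=> u /B_cap cu; apply/esym/rho_eq0; exact: le_trans cu D0.
  rewrite (measure_sphere_set1 m_gt0 sigma_inv) leNgt => /negP; apply.
  exact: lt_le_trans A0 AB.
- apply: (le_trans AB); apply: le_measure; rewrite ?inE//; exact: measurable_cap.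
- move=> r /andP[r0 rD]; have [_ [u Bu <-] ru] := sup_gt supD.1 rD.
  (* Compare [v] with a point [u] of [B] that is farther than [r] from [c]. *)
  have cap_B v : rho c v <= r -> t <= g v.
    by move=> vr; rewrite (le_trans Bu)// g_mono// (le_lt_trans vr).
  have ge_t v : t <= g v + cap_dist c r v.
    have [vr|rv] := leP (rho c v) r.
      by rewrite /cap_dist max_l ?subr_le0// addr0 cap_B.
    rewrite /cap_dist max_r; last by rewrite subr_ge0 ltW.
    have [|p [cp <-]] := @sphere_geodesic _ _ m_gt0 c v r; first by rewrite !ltW.
    have := cap_B p; rewrite cp lexx => /(_ isT) tp.
    by have := Kg.1 p v; rewrite ler_norml => /andP[_ ?]; lra.
  have lg := rho_lipschitz1 Kg.1; have lc := rho_lipschitz1 (cap_dist_lip1 c r).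
  have := mean_le sigma (rho_lipschitz_cst t) (rho_lipschitzD lg lc) ge_t.
  by rewrite mean_cst meanD// (equimeasurable_mean Kg) /t addrC lerD2l.
Qed.

Lemma cap_dist_antimono c (r s : R) u : r <= s ->
  cap_dist c s u <= cap_dist c r u <= cap_dist c s u + (s - r).
Proof.
move=> rs; rewrite /cap_dist.
by case: (leP 0 (rho c u - r)); case: (leP 0 (rho c u - s)); lra.
Qed.

Lemma deviationE f x : rho_lipschitz f ->
  deviation sigma f x = sigma [set u | x <= f u - mean f].
Proof.
by move=> lf; rewrite /deviation unlock (mean_EFin sigma lf).
Qed.

Lemma cap_dist_lip1_class c (r : R) : 0 <= r ->
  lip1_class sigma (fun u => - rho_set (cap c r) u).
Proof.
move=> r0; have E : (fun u => - rho_set (cap c r) u) = (fun u => - cap_dist c r u).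
  by apply/funext => u; rewrite rho_set_cap.
have L u v : `|- cap_dist c r u - - cap_dist c r v| <= rho u v.
  by rewrite opprK addrC distrC cap_dist_lip1.
rewrite E; split; last exact: L.
exact/rho_lipschitz_integrable/rho_lipschitz1.
Qed.

Lemma deviation_cap c (r x : R) : 0 <= r ->
  deviation sigma (fun u => - rho_set (cap c r) u) x =
  sigma [set u | x + cap_dist c r u <= mean (cap_dist c r)].
Proof.
move=> r0; have lc := rho_lipschitz1 (cap_dist_lip1 c r).
rewrite (_ : (fun u => - rho_set _ u) = (fun u => - cap_dist c r u)); last first.
  by apply/funext => u; rewrite rho_set_cap.
rewrite deviationE ?meanN//; last exact: rho_lipschitzN.
by congr (sigma _); apply/seteqP; split => u /=; lra.
Qed.

Lemma sup_deviation_attained c (r x : R) : 0 < r ->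
  (forall f, lip1_class sigma f -> (deviation sigma f x <=
    deviation sigma (fun u => (- rho_set (cap c r) u)%R) x)%E) ->
  exists A : set (sphere R m), is_cap A /\
    sup_deviation sigma x = deviation sigma (fun u => - rho_set A u) x.
Proof.
move=> r0 max; exists (cap c r); split; first by exists c, r.
apply/le_anti/andP; split; first by apply: ub_ereal_sup => _ [f fF <-]; exact: max.
apply: ereal_sup_ubound; exists (fun u => - rho_set (cap c r) u) => //.
exact/cap_dist_lip1_class/ltW.
Qed.

(** For [x > 0] the optimal radius is the supremum of the set [S] of radii [r > 0] with
    [x <= mean (cap_dist c r)]; it belongs to [S] by continuity in [r].  If [S] is empty,
    all deviations at [x] vanish. *)
Lemma sup_deviation_cap x : exists A : set (sphere R m), is_cap A /\
    sup_deviation sigma x = deviation sigma (fun u => - rho_set A u) x.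
Proof.
pose c : sphere R m := point.
have cap_dist_pi (r : R) : pi <= r -> cap_dist c r = fun=> 0.
  move=> pir; apply/funext => u; rewrite /cap_dist max_l// subr_le0.
  exact: le_trans (rho_lepi _ _) pir.
have msup f : lip1_class sigma f -> measurable [set u | x <= f u - mean f].
  move=> [_ fL]; apply: measurable_superlevel.
  exact/(rho_lipschitzD (rho_lipschitz1 fL))/rho_lipschitz_cst.
have [x0|x0] := leP x 0.
  apply: (@sup_deviation_attained c pi) => [|f fF]; first exact: pi_gt0.
  rewrite (deviation_cap _ _ (pi_ge0 _)) cap_dist_pi// mean_cst.
  rewrite (_ : [set _ | _] = setT); last first.
    by apply/seteqP; split => // u _ /=; rewrite addr0.
  rewrite (probability_setT sigma) (deviationE _ (rho_lipschitz1 fF.2)).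
  exact: probability_le1 (msup _ fF).
pose S := [set r | 0 < r /\ x <= mean (cap_dist c r)].
have dom f : lip1_class sigma f -> (0 < sigma [set u | (x <= f u - mean f)%R])%E ->
    exists r : R, [/\ 0 < r, (sigma [set u | (x <= f u - mean f)%R] <= sigma (cap c r))%E
      & forall r', 0 < r' < r -> S r'].
  move=> [_ fL] /(cap_dominates c fL)[r [r0 le_r r_mean]]; exists r; split=> // r' r'r.
  by split; [by case/andP: r'r|exact: r_mean].
have dev0 f : lip1_class sigma f ->
    (deviation sigma f x = 0 \/ 0 < sigma [set u | (x <= f u - mean f)%R])%E.
  move=> [_ fL]; rewrite (deviationE _ (rho_lipschitz1 fL)).
  have : (0 <= sigma [set u | (x <= f u - mean f)%R])%E by exact: measure_ge0.
  by rewrite le_eqVlt => /predU1P[<-|]; [left|right].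
have dev_ge0 f : lip1_class sigma f -> (0 <= deviation sigma f x)%E.
  by move=> [_ fL]; rewrite (deviationE _ (rho_lipschitz1 fL)) measure_ge0.
have [S0|/set0P S0] := eqVneq S set0.
  apply: (@sup_deviation_attained c 1) => // f fF.
  have [->|/(dom _ fF)[r [r0 _ rS]]] := dev0 _ fF.
    by apply: dev_ge0; exact: cap_dist_lip1_class ler01.
  have : S (r / 2) by apply: rS; lra.
  by rewrite S0.
(* A cap of radius at least [pi] is the whole sphere and contradicts [0 < x]. *)
have ubS : ubound S pi.
  move=> r [r0]; apply: contraTT; rewrite -!ltNge => pir.
  by rewrite cap_dist_pi ?mean_cst// ltW.
have supS : has_sup S by split => //; exists pi.
have le_sup r : S r -> r <= sup S by move=> Sr; apply: ub_le_sup => //; exists pi.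
have sup0 : 0 < sup S by have [r Sr] := S0; exact: lt_le_trans Sr.1 (le_sup _ Sr).
have lcd r := rho_lipschitz1 (cap_dist_lip1 c r).
have x_mean : x <= mean (cap_dist c (sup S)).
  apply/ler_addgt0Pr => e e0; have [r Sr re] := sup_adherent e0 supS.
  apply: (le_trans Sr.2); rewrite -[e](mean_cst sigma) -meanD//; last first.
    exact: rho_lipschitz_cst.
  apply: mean_le => //; first exact/rho_lipschitzD/rho_lipschitz_cst.
  by move=> u; have := cap_dist_antimono c u (le_sup _ Sr); lra.
apply: (@sup_deviation_attained c (sup S)) => // f fF.
have [->|Af] := dev0 _ fF.
  by apply: dev_ge0; exact: cap_dist_lip1_class (ltW sup0).
have [r [r0 le_r rS]] := dom _ fF Af.
have r_sup : r <= sup S.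
  rewrite leNgt; apply/negP => rs.
  (* All radii below [r] lie in [S], so [r] cannot exceed the supremum. *)
  by have /le_sup : S ((r + sup S) / 2) by [apply: rS; lra]; lra.
rewrite (deviationE _ (rho_lipschitz1 fF.2)) (le_trans le_r)//.
rewrite (deviation_cap _ _ (ltW sup0)); apply: le_measure; rewrite ?inE.
- exact: measurable_cap.
- rewrite (_ : [set u | _] =
    [set u | x - mean (cap_dist c (sup S)) <= - cap_dist c (sup S) u]).
    exact: (measurable_superlevel _ (rho_lipschitzN (lcd (sup S)))).
  by apply/seteqP; split => u /=; lra.
- move=> u /= ur; rewrite [cap_dist c (sup S) u]max_l ?addr0//.
  by rewrite subr_le0 (le_trans ur).
Qed.

End Caps.

Theorem corollary3 (R : realType) (n : nat) (n_ge2 : (2 <= n)%N)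
    (sigma : probability (sphere R n.-1) R)
    (sigma_inv : rotation_invariant sigma) (x : R) :
  exists A_opt : set (sphere R n.-1),
    is_cap A_opt /\
    sup_deviation sigma x = deviation sigma (fun u => - rho_set A_opt u) x.
Proof.
have m_gt0 : (0 < n.-1)%N by case: n n_ge2 {sigma sigma_inv} => [|[]].
exact: (sup_deviation_cap m_gt0 sigma_inv).
Qed.
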